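(* Let $T=(F,E,p,q)$ be a left-resolving textile system such that $F$ and $E$ are finite graphs, with dual textile system $\overline{T}=(\overline{F},\overline{E},\overline{p},\overline{q})$, diagonal graph $\Delta_T$ and associated $2$-graph $\Lambda_T$. Then the following are equivalent. (i) $\mathsf{X}_T^+$ is nonempty. (ii) $\mathsf{X}_{\Delta_T}^+$ is nonempty. (iii) $\Delta_T$ contains a cycle. (iv) There exist paths $\alpha\in E^*$, $\beta\in\overline{E}^*$ such that $|\alpha|=|\beta|$, $s_E(\alpha)=r_{\overline{E}}(\beta)$, $r_E(\alpha)=s_{\overline{E}}(\beta)$. (v) There exist $n\in\mathbb{N}\setminus\{0\}$ and words $\nu\in\mathcal{B}_n(\mathsf{X}_F)$, $\omega\in\mathcal{B}_n(\mathsf{X}_{\overline{F}})$ such that $\nu_1=\omega_n$ and $\nu_n=\omega_1$. (vi) There exist $u,v\in\Lambda_T^0$ and $n\in\mathbb{N}\setminus\{0\}$ such that $u\Lambda_T^{n\mathbf{e}_1}v\neq\emptyset$ and $v\Lambda_T^{n\mathbf{e}_2}u\neq\emptyset$.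
   Context: A directed graph is written $E=(E^0,E^1,r_E,s_E)$ (vertices, edges, range map, source map). $E^*$ denotes the free category (path category) of $E$: its elements are the vertices (paths of length $0$) and the paths $e_1e_2\cdots e_m$ of edges with $r_E(e_i)=s_E(e_{i+1})$, which have source $s_E(e_1)$, range $r_E(e_m)$ and length $m$; the length of $\alpha$ is written $|\alpha|$. A graph homomorphism $f:F\to E$ is a pair $(f^0,f^1)$, $f^i:F^i\to E^i$, commuting with ranges and sources (superscripts are often dropped). $\mathbb{N}$ includes $0$; $\mathbf{e}_1,\mathbf{e}_2$ are the canonical basis vectors of $\mathbb{Z}^2$. A textile system is a quadruple $T=(F,E,p,q)$ with $F,E$ directed graphs and $p,q:F\to E$ graph homomorphisms such that $f\mapsto (s_F(f),r_F(f),p(f),q(f))$ is injective on $F^1$. A homomorphism $p:F\to E$ has unique $r$-path lifting (resp. unique $s$-path lifting) if whenever $v\in F^0$, $e\in E^1$ and $p^0(v)=r_E(e)$ (resp. $p^0(v)=s_E(e)$), there is a unique $f\in F^1$ with $r_F(f)=v$ (resp. $s_F(f)=v$) and $p^1(f)=e$. $T$ is left-resolving (LR) if $p$ has unique $r$-path lifting and $q$ has unique $s$-path lifting. The dual textile system $\overline{T}=(\overline{F},\overline{E},\overline{p},\overline{q})$ has $\overline{F}=(E^1,F^1,q^1,p^1)$, $\overline{E}=(E^0,F^0,q^0,p^0)$ (so in $\overline E$ the edge $w\in F^0$ has range $q^0(w)$ and source $p^0(w)$), $\overline{p}=(s_E,s_F)$, $\overline{q}=(r_E,r_F)$. $\mathsf{X}_T^+:=\{x:\mathbb{N}^2\to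 F^1 \mid r_F(x_{\mathbf n})=s_F(x_{\mathbf n+\mathbf e_1}),\ q(x_{\mathbf n})=p(x_{\mathbf n+\mathbf e_2})\ \forall \mathbf n\in\mathbb{N}^2\}$. The diagonal graph is $\Delta_T:=(E^0,F^1,r_E\circ q,s_E\circ p)$, and $\mathsf{X}_{\Delta_T}^+:=\{y\in (F^1)^{\mathbb{N}}\mid r_E(q(y_n))=s_E(p(y_{n+1}))\ \forall n\in\mathbb{N}\}$. For a directed graph $H$, $\mathsf{X}_H:=\{x\in (H^1)^{\mathbb{Z}}\mid r_H(x_i)=s_H(x_{i+1})\ \forall i\in\mathbb{Z}\}$ is its edge shift, and $\mathcal{B}_n(\mathsf{X}_H)$ is the set of words $\nu=\nu_1\cdots\nu_n$ of length $n$ occurring in elements of $\mathsf{X}_H$. (Both $\mathsf{X}_F$ and $\mathsf{X}_{\overline F}$ have alphabet $F^1$.) The $2$-graph $\Lambda_T$ of an LR textile system: let $G_T$ be the $2$-colored graph with vertex set $E^0$ and edge set $F^0\sqcup E^1$, where $w\in F^0$ goes from $p^0(w)$ to $q^0(w)$ and has color $\mathbf e_2$, and $e\in E^1$ goes from $s_E(e)$ to $r_E(e)$ and has color $\mathbf e_1$. $\Lambda_T$ is the quotient of the path category of $G_T$ by the congruence generated by identifying the paths $s_F(f)q^1(f)$ and $p^1(f)r_F(f)$, $f\in F^1$ (paths written in order of traversal), with degree functor $d:\Lambda_T\to\mathbb{N}^2$ obtained by adding colors. As a $2$-graph, the range $r_{\Lambda_T}$ (resp. source $s_{\Lambda_T}$)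 of the class of a path is its initial (resp. terminal) vertex. $\Lambda_T^{0}=E^0$, $\Lambda_T^{\mathbf n}=d^{-1}(\mathbf n)$, and $u\Lambda_T^{\mathbf n}v=\{\lambda\in\Lambda_T^{\mathbf n}\mid r_{\Lambda_T}(\lambda)=u,\ s_{\Lambda_T}(\lambda)=v\}$.
   Formalization: In (iv) the paths α and β are required to have positive length; with paths of length 0 allowed, (iv) would hold whenever E has a vertex, and the equivalence would fail (e.g. E one vertex without edges, F empty). *)

(* Defs.v *)
From mathcomp Require Import all_boot all_order all_algebra.
From mathcomp Require Import boolp classical_sets cardinality.

Set Implicit Arguments.
Unset Strict Implicit.
Unset Printing Implicit Defensive.

Import GRing.Theory.
Local Open Scope classical_set_scope.

Record digraph := Digraph {
  vertex : Type;
  edge : Type;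
  ran : edge -> vertex;
  src : edge -> vertex
}.

Definition finite_graph (G : digraph) : Prop :=
  finite_set [set: vertex G] /\ finite_set [set: edge G].

Record ghom (F E : digraph) := GHom {
  hom0 : vertex F -> vertex E;
  hom1 : edge F -> edge E;
  hom_ran : forall f, hom0 (ran f) = ran (hom1 f);
  hom_src : forall f, hom0 (src f) = src (hom1 f)
}.

Fixpoint walk (G : digraph) (u : vertex G) (l : seq (edge G)) : Prop :=
  if l is e :: l' then src e = u /\ walk (ran e) l' else True.

(* An element of the free category G^*. The initial vertex is recorded so    *)
(* that paths of length 0 are exactly the vertices; edges are listed in      *)
(* order of traversal.                                                       *)
Record gpath (G : digraph) := GPath {
  psrc : vertex G;
  pedges : seq (edge G);
  pwalk : walk psrc pedges
}.

Definition pran (G : digraph) (x : gpath G) : vertex G :=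
  last (psrc x) (map (@ran G) (pedges x)).

Definition plength (G : digraph) (x : gpath G) : nat := size (pedges x).

Lemma walk_cat (G : digraph) (u : vertex G) (l l' : seq (edge G)) :
  walk u l -> walk (last u (map (@ran G) l)) l' -> walk u (l ++ l').
Proof.
by elim: l u => [|e l IHl] //= u [-> wl] wl'; split=> //; exact: IHl.
Qed.

Lemma pcomp_subproof (G : digraph) (x y : gpath G) :
  pran x = psrc y -> walk (psrc x) (pedges x ++ pedges y).
Proof.
by move=> xy; apply: walk_cat (pwalk x) _; rewrite -/(pran x) xy; exact: pwalk.
Qed.

Definition pcomp (G : digraph) (x y : gpath G) (xy : pran x = psrc y) :
  gpath G := GPath (pcomp_subproof xy).

(* Vertices may be repeated along a cycle. *)
Definition has_cycle (G : digraph) : Prop :=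
  exists c : gpath G, 0 < plength c /\ psrc c = pran c.

Record textile := Textile {
  tF : digraph;
  tE : digraph;
  tp : ghom tF tE;
  tq : ghom tF tE;
  textile_inj :
    injective (fun f : edge tF => (src f, ran f, hom1 tp f, hom1 tq f))
}.

Definition unique_r_lifting (F E : digraph) (p : ghom F E) : Prop :=
  forall (v : vertex F) (e : edge E), hom0 p v = ran e ->
    exists! f : edge F, ran f = v /\ hom1 p f = e.

Definition unique_s_lifting (F E : digraph) (p : ghom F E) : Prop :=
  forall (v : vertex F) (e : edge E), hom0 p v = src e ->
    exists! f : edge F, src f = v /\ hom1 p f = e.

Definition left_resolving (T : textile) : Prop :=
  unique_r_lifting (tp T) /\ unique_s_lifting (tq T).

Section Dual.
Variable T : textile.
Local Notation F := (tF T).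
Local Notation E := (tE T).
Local Notation p := (tp T).
Local Notation q := (tq T).

Definition dualF : digraph := Digraph (hom1 q) (hom1 p).
Definition dualE : digraph := Digraph (hom0 q) (hom0 p).

Definition dualp : ghom dualF dualE :=
  @GHom dualF dualE (@src E) (@src F)
    (fun f => esym (hom_src q f)) (fun f => esym (hom_src p f)).

Definition dualq : ghom dualF dualE :=
  @GHom dualF dualE (@ran E) (@ran F)
    (fun f => esym (hom_ran q f)) (fun f => esym (hom_ran p f)).

Lemma dual_inj : injective
  (fun f : edge dualF => (src f, ran f, hom1 dualp f, hom1 dualq f)).
Proof.
by move=> f g [pfg qfg sfg rfg]; apply: (@textile_inj T); rewrite /= pfg qfg sfg rfg.
Qed.

Definition dual : textile := Textile dual_inj.

Definition diagonal_graph : digraph :=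
  @Digraph (vertex E) (edge F) (fun f => ran (hom1 q f))
    (fun f => src (hom1 p f)).

End Dual.

(* The first coordinate is the horizontal one: e_1 follows range and source  *)
(* in F, e_2 follows p and q.                                                *)
Definition quadrant_shift (T : textile) : set (nat * nat -> edge (tF T)) :=
  [set x | forall i j : nat,
     ran (x (i, j)) = src (x (i.+1, j)) /\
     hom1 (tq T) (x (i, j)) = hom1 (tp T) (x (i, j.+1))].

Definition one_sided_edge_shift (G : digraph) : set (nat -> edge G) :=
  [set y | forall n : nat, ran (y n) = src (y n.+1)].

Definition edge_shift (G : digraph) : set (int -> edge G) :=
  [set x | forall i : int, ran (x i) = src (x (i + 1)%R)].

Definition words (A : Type) (X : set (int -> A)) (n : nat) : set (n.-tuple A) :=
  [set w | exists2 x, X x &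
     exists i : int, forall k : 'I_n, tnth w k = x (i + k%:Z)%R].

Arguments quadrant_shift : clear implicits.
Arguments one_sided_edge_shift : clear implicits.
Arguments edge_shift : clear implicits.

Section TwoGraph.
Variable T : textile.
Local Notation F := (tF T).
Local Notation E := (tE T).
Local Notation p := (tp T).
Local Notation q := (tq T).

(* [inl w], with w a vertex of F, has color e_2; [inr e], with e an edge of  *)
(* E, has color e_1.                                                         *)
Definition colored_graph : digraph :=
  @Digraph (vertex E) (vertex F + edge E)%type
    (fun a => match a with inl w => hom0 q w | inr e => ran e end)
    (fun a => match a with inl w => hom0 p w | inr e => src e end).

Definition has_color2 (a : edge colored_graph) : bool :=
  if a is inl _ then true else false.

Lemma upper_path_subproof (f : edge F) :
  @walk colored_graph (hom0 p (src f)) [:: inl (src f); inr (hom1 q f)].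
Proof. by split=> //=; split=> //; rewrite hom_src. Qed.

Lemma lower_path_subproof (f : edge F) :
  @walk colored_graph (src (hom1 p f)) [:: inr (hom1 p f); inl (ran f)].
Proof. by split=> //=; split=> //; rewrite hom_ran. Qed.

(* The two sides identified by f, namely s_F(f) q(f) and p(f) r_F(f). *)
Definition upper_path (f : edge F) : gpath colored_graph :=
  GPath (upper_path_subproof f).

Definition lower_path (f : edge F) : gpath colored_graph :=
  GPath (lower_path_subproof f).

Inductive square_cong : gpath colored_graph -> gpath colored_graph -> Prop :=
| square_cong_gen f : square_cong (upper_path f) (lower_path f)
| square_cong_refl x : square_cong x x
| square_cong_sym x y : square_cong x y -> square_cong y x
| square_cong_trans x y z :
    square_cong x y -> square_cong y z -> square_cong x z
| square_cong_comp x x' y y' (xy : pran x = psrc y) (xy' : pran x' = psrc y') :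
    square_cong x x' -> square_cong y y' ->
    square_cong (pcomp xy) (pcomp xy').

Definition path_degree (x : gpath colored_graph) : nat * nat :=
  (count (predC has_color2) (pedges x), count has_color2 (pedges x)).

Lemma square_cong_inv x y : square_cong x y ->
  [/\ psrc x = psrc y, pran x = pran y & path_degree x = path_degree y].
Proof.
elim=> [f|//|{}x {}y _ [-> -> ->] //|{}x {}y z _ [-> -> ->] _ //|].
  by split; rewrite /pran //= ?hom_src ?hom_ran.
move=> {}x x' {}y y' xy xy' _ [sx rx dx] _ [sy ry dy]; split=> //.
  have rcomp a b (ab : pran a = psrc b) : pran (@pcomp colored_graph a b ab) = pran b.
    by rewrite /pran /= map_cat last_cat -/(pran a) ab.
  by rewrite !rcomp.
by move: dx dy; rewrite /path_degree /= !count_cat => -[-> ->] [-> ->].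
Qed.

Record two_graph := TwoGraph {
  tg_class : set (gpath colored_graph);
  tg_classP : exists x, tg_class = square_cong x
}.

Definition tg_of (x : gpath colored_graph) : two_graph :=
  @TwoGraph (square_cong x) (ex_intro _ x erefl).

Definition tg_repr (l : two_graph) : gpath colored_graph :=
  sval (cid (tg_classP l)).

(* In Lambda_T the range is the initial vertex and the source the terminal   *)
(* vertex; by [tg_ofE] these and the degree do not depend on the             *)
(* representative.                                                           *)
Definition tg_ran (l : two_graph) : vertex E := psrc (tg_repr l).
Definition tg_src (l : two_graph) : vertex E := pran (tg_repr l).
Definition tg_degree (l : two_graph) : nat * nat := path_degree (tg_repr l).

Lemma tg_repr_cong x : square_cong (tg_repr (tg_of x)) x.
Proof.
rewrite /tg_repr; case: cid => y /= xy.
by rewrite -xy; exact: square_cong_refl.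
Qed.

Lemma tg_ofE x : [/\ tg_ran (tg_of x) = psrc x, tg_src (tg_of x) = pran x
  & tg_degree (tg_of x) = path_degree x].
Proof. exact: square_cong_inv (tg_repr_cong x). Qed.

Definition tg_hom (u : vertex E) (n : nat * nat) (v : vertex E) :
  set two_graph :=
  [set l | [/\ tg_degree l = n, tg_ran l = u & tg_src l = v]].

End TwoGraph.

Arguments tg_hom : clear implicits.

(* Main.v *)
Require Import Defs.
From mathcomp Require Import all_boot all_order all_algebra.
From mathcomp Require Import boolp classical_sets cardinality.

(** View the edges of F as unit squares, with bottom p, top q, left side s and
    right side r.  Left-resolving means that a square is determined by its lower
    right corner (p, r), and also by its upper left corner (s, q).  Pushing a
    vertical edge along a horizontal path, in either direction, thus turns a
    staircase of squares into a horizontal path followed by a vertical path of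
    the same length, and back: diagonal paths of length n exist exactly where
    such corners of size n do.  Squares placed along a bi-infinite diagonal path
    can likewise be completed, one diagonal after the other, to a tiling of the
    plane.  In (v), it is enough that the two words meet at one square: the row
    to the left of it and the column above it are corners of every size, so that
    diagonal paths are arbitrarily long, and finiteness yields a cycle. *)

Set Implicit Arguments.
Unset Strict Implicit.
Unset Printing Implicit Defensive.

Local Open Scope classical_set_scope.

(** Choice turns the two hypotheses into step functions; their iterates from [x] fill the two
    half-lines. *)
Lemma bi_infinite_orbit (D : Type) (P : D -> Prop) (R : D -> D -> Prop) :
    (forall x, P x -> exists2 y, P y & R x y) ->
    (forall x, P x -> exists2 y, P y & R y x) ->
  forall x, P x ->
    exists2 o : int -> D, o 0%R = x &
      forall k : int, P (o k) /\ R (o k) (o (k + 1)%R).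
Proof.
move=> fwd bwd x Px.
(* Outside [P] a point serves as its own dummy image, so that choice gives total functions. *)
have total S : (forall x, P x -> exists2 y, P y & S x y) ->
    forall x, exists y, P x -> P y /\ S x y.
  move=> tS z; have [Pz|nPz] := pselect (P z); last by exists z.
  by have [y Py Szy] := tS z Pz; exists y.
have [f fP] := choice (total R fwd).
have [g gP] := choice (total (fun x y => R y x) bwd).
have Pf n : P (iter n f x) by elim: n => //= n /fP[].
have Pg n : P (iter n g x) by elim: n => //= n /gP[].
(* [Negz n] stands for -(n+1), hence the extra backward step. *)
exists (fun k => match k with Posz n => iter n f x | Negz n => iter n.+1 g x end) => //.
case=> n; first by rewrite -PoszD addn1; split=> //; exact: (fP _ (Pf n)).2.
split=> //; have := (gP _ (Pg n)).2; case: n => [|n] //.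
by have -> : (Negz n.+1 + 1 = Negz n)%R by rewrite !NegzE -addn1 PoszD GRing.opprD GRing.subrK.
Qed.

(** * Paths reduced to their length and end points, and cycles *)

Fixpoint reach (G : digraph) (n : nat) (u v : vertex G) : Prop :=
  if n is m.+1 then exists2 e : edge G, src e = u & reach m (ran e) v else u = v.

Lemma reachP (G : digraph) n (u v : vertex G) :
  reach n u v <-> exists c : gpath G, [/\ plength c = n, psrc c = u & pran c = v].
Proof.
split=> [|[[w l wl] [/= <- <- <-]]]; last first.
  rewrite /pran /plength /= {u v}.
  by elim: l w wl => //= e l IHl w [sw wl]; exists e => //; exact: IHl.
elim: n u => [|n IHn] u /=; first by move=> <-; exists (@GPath G u [::] I).
move=> [e se /IHn[[w l wl] [/= ln wE <-]]]; subst w.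
by exists (@GPath G u (e :: l) (conj se wl)); rewrite -ln.
Qed.

Lemma has_cycleP (G : digraph) :
  has_cycle G <-> exists n (u : vertex G), reach n.+1 u u.
Proof.
split=> [[c [c0 cc]]|[n [u /reachP[c [cn cu cv]]]]].
  exists (plength c).-1, (psrc c); rewrite prednK//.
  by apply/reachP; exists c; rewrite -cc.
by exists c; rewrite cn cu cv.
Qed.

Lemma reach_rcons (G : digraph) n (u v : vertex G) :
  reach n.+1 u v <-> exists2 e : edge G, ran e = v & reach n u (src e).
Proof.
elim: n u => [|n IHn] u.
  by split=> [[e <- <-]|[e <- ->]]; exists e.
split=> [[e eu /IHn[f fv ef]]|[f fv [e eu ef]]].
  by exists f => //; exists e.
by exists e => //; apply/IHn; exists f.
Qed.

Lemma reach_sequence (G : digraph) (y : nat -> edge G) n :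
  one_sided_edge_shift G y -> reach n (src (y 0)) (src (y n)).
Proof.
elim: n y => [//|n IHn] y yP; exists (y 0) => //.
by rewrite yP; apply: (IHn (fun k => y k.+1)) => k; exact: yP.
Qed.

Lemma reach_vertices (G : digraph) n (u v : vertex G) : reach n u v ->
  exists2 y : nat -> vertex G, y 0 = u &
    forall i j, i + j <= n -> reach j (y i) (y (i + j)).
Proof.
elim: n u => [|n IHn] u /=.
  by move=> _; exists (fun=> u) => // i j; rewrite leqn0 addn_eq0 => /andP[_ /eqP->].
move=> [e eu /IHn[y y0 yP]].
exists (fun i => if i is i'.+1 then y i' else u) => // -[|i] j ijn; last exact: yP.
case: j ijn => [//|j jn]; exists e => //.
by rewrite -y0; exact: yP.
Qed.

(** Pigeonhole: a path whose length is the number [m] of vertices makes [m.+1] visits, so it returns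
    somewhere. *)
Lemma long_paths_cycle (G : digraph) : finite_set [set: vertex G] ->
  (forall n, exists u v : vertex G, reach n u v) -> has_cycle G.
Proof.
move=> [m /card_set_bijP[g [gm ginj _]]] /(_ m)[u [v /reach_vertices[y _ yP]]].
have ltm w : g w < m by apply: gm.
have : ~~ injectiveb (fun i : 'I_m.+1 => Ordinal (ltm (y i))).
  by apply/negP => /injectiveP/leq_card; rewrite !card_ord ltnn.
move=> /injectivePn[i [j nij [gij]]].
have {gij} yij : y i = y j by apply: ginj gij; rewrite in_setE.
apply/has_cycleP; wlog ij : i j nij yij / i < j.
  move=> wl; have : i != j :> nat by [].
  by rewrite neq_ltn => /orP[/wl|/wl]; apply; rewrite // eq_sym.
exists (j - i).-1, (y i); have := yP i (j - i).
rewrite subnKC ?(ltnW ij)// -yij prednK ?subn_gt0//; apply.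
by rewrite -ltnS.
Qed.

(** An edge on a cycle has a successor and a predecessor that lie on a cycle too. *)
Lemma cycle_edge_shift (G : digraph) : has_cycle G -> edge_shift G !=set0.
Proof.
move=> /has_cycleP[n [u [e eu eu']]].
pose on_cycle (f : edge G) := exists k, reach k (ran f) (src f).
have on_e : on_cycle e by exists n; rewrite eu.
have [||o _ oP] :=
    @bi_infinite_orbit _ on_cycle (fun f g => ran f = src g) _ _ e on_e.
- move=> f [[/= ff|k [g gf fk]]]; first by exists f => //; exists 0.
  by exists g => //; exists k.+1; apply/reach_rcons; exists f.
- move=> f [[/= ff|k /reach_rcons[g gf fk]]]; first by exists f => //; exists 0.
  by exists g => //; exists k.+1; rewrite /= gf; exists f.
- by exists o => i; exact: (oP i).2.
Qed.

(** * Pushing edges through squares, and tilings of the plane *)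

Section LeftResolving.
Variable T : textile.
Hypothesis hLR : left_resolving T.
Local Notation F := (tF T).
Local Notation E := (tE T).
Local Notation p := (tp T).
Local Notation q := (tq T).
Local Notation Delta := (diagonal_graph T).

Lemma lower_right_square (w : vertex F) (e : edge E) : hom0 p w = ran e ->
  exists2 f : edge F, ran f = w & hom1 p f = e.
Proof. by move=> /hLR.1[f [[fw fe] _]]; exists f. Qed.

Lemma upper_left_square (w : vertex F) (e : edge E) : hom0 q w = src e ->
  exists2 f : edge F, src f = w & hom1 q f = e.
Proof. by move=> /hLR.2[f [[fw fe] _]]; exists f. Qed.

(** The edge [w] moves right beneath the given path, each square being found from its upper left
    corner. *)
Lemma push_down n (w : vertex F) v : @reach E n (hom0 q w) v ->
  exists2 w', @reach E n (hom0 p w) (hom0 p w') & hom0 q w' = v.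
Proof.
elim: n w => [|n IHn] w /=; first by move=> <-; exists w.
move=> [e /esym/upper_left_square[f fw fe]].
rewrite -fe -hom_ran => /IHn[w' pw' qw'].
by exists w' => //; exists (hom1 p f); rewrite -?hom_src -?hom_ran ?fw.
Qed.

Lemma push_up n u (w : vertex F) : @reach E n u (hom0 p w) ->
  exists2 w', hom0 p w' = u & @reach E n (hom0 q w') (hom0 q w).
Proof.
elim: n u => [|n IHn] u /=; first by move=> ->; exists w.
move=> [e <- /IHn[w1 /lower_right_square[f fw fe] w1P]].
exists (src f); first by rewrite hom_src fe.
by exists (hom1 q f); rewrite -?hom_src -?hom_ran ?fw.
Qed.

(** Past the first square [f], induction gives a corner; pushing the right side of [f] beneath its
    horizontal leg enlarges it by one. *)
Lemma diagonal_corner n u v : @reach Delta n u v ->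
  exists2 m, @reach E n u m & @reach (dualE T) n m v.
Proof.
elim: n u => [|n IHn] u /=; first by move=> <-; exists u.
move=> [f <- /IHn[m]]; rewrite -hom_ran => /push_down[w' pw' qw'] mv.
exists (hom0 p w'); first by exists (hom1 p f); rewrite -?hom_ran.
by exists w'; rewrite ?qw'.
Qed.

(** Pushing the lowest vertical edge left over all but the first horizontal edge exposes the first
    square and leaves a smaller corner. *)
Lemma corner_diagonal n u m v : @reach E n u m -> @reach (dualE T) n m v ->
  @reach Delta n u v.
Proof.
elim: n u m => [|n IHn] u m /=; first by move=> ->.
move=> [e <- em] [w wm wv]; move: em; rewrite -wm => /push_up[w' pw' em].
have [f fw fe] := lower_right_square pw'.
exists f; first by rewrite fe.
by rewrite -hom_ran fw; apply: IHn em wv.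
Qed.

(** The diagonal [z] is adjacent to [y] on its lower right: [z k] lies right of [y k] and below
    [y (k + 1)]. *)
Definition follows (y z : int -> edge F) : Prop :=
  forall k : int, src (z k) = ran (y k) /\ hom1 q (z k) = hom1 p (y (k + 1)%R).

Lemma diagonal_below (y : int -> edge F) : edge_shift Delta y ->
  exists2 z, edge_shift Delta z & follows y z.
Proof.
move=> yP; have /choice[z zP] (k : int) : exists f : edge F,
    src f = ran (y k) /\ hom1 q f = hom1 p (y (k + 1)%R).
  have [|f fs fq] := @upper_left_square (ran (y k)) (hom1 p (y (k + 1)%R)).
    by rewrite hom_ran; exact: yP.
  by exists f.
exists z => // k /=.
by rewrite (zP k).2 -hom_ran -(zP (k + 1)%R).1 hom_src.
Qed.

Lemma diagonal_above (z : int -> edge F) : edge_shift Delta z ->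
  exists2 y, edge_shift Delta y & follows y z.
Proof.
move=> zP; have /choice[y yP] (k : int) : exists f : edge F,
    ran f = src (z k) /\ hom1 p f = hom1 q (z (k - 1)%R).
  have [|f fs fq] := @lower_right_square (src (z k)) (hom1 q (z (k - 1)%R)).
    by rewrite hom_src; have := zP (k - 1)%R; rewrite /= GRing.subrK.
  by exists f.
exists y => k /=.
  by rewrite (yP (k + 1)%R).2 GRing.addrK -hom_ran (yP k).1 hom_src.
by rewrite (yP k).1 (yP (k + 1)%R).2 GRing.addrK.
Qed.

Lemma cycle_plane : has_cycle Delta -> exists x : int -> int -> edge F,
  forall i j, ran (x i j) = src (x (i + 1)%R j) /\
              hom1 q (x i j) = hom1 p (x i (j + 1)%R).
Proof.
move=> /cycle_edge_shift[y yP].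
have [Y _ YP] := bi_infinite_orbit diagonal_below diagonal_above yP.
(* Column minus row is constant along a diagonal and numbers it; the row is the position on it. *)
exists (fun i j => Y (i - j)%R j) => i j; split.
  by rewrite GRing.addrAC ((YP _).2 j).1.
have := ((YP (i - j - 1)%R).2 j).2.
by rewrite GRing.subrK => ->; rewrite GRing.opprD GRing.addrA.
Qed.

Lemma meeting_shifts_cycle (x z : int -> edge F) (i j : int) :
    finite_set [set: vertex E] -> edge_shift F x -> edge_shift (dualF T) z ->
  x i = z j -> has_cycle Delta.
Proof.
move=> finE xP zP xz; apply: long_paths_cycle => // n.
(* The bottoms [a], started [n] squares to the left, and the left sides [b] meet at the lower left
   vertex of the common square. *)
pose a k := hom1 p (x (i - n%:Z + k%:Z)%R).
pose b k := src (z (j + k%:Z)%R).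
have aP : one_sided_edge_shift E a.
  by move=> k; rewrite /a -hom_ran xP hom_src -addn1 PoszD GRing.addrA.
have bP : one_sided_edge_shift (dualE T) b.
  move=> k; rewrite /b /= hom_src; have /= -> := zP (j + k%:Z)%R.
  by rewrite hom_src -addn1 PoszD GRing.addrA.
exists (src (a 0)), (@src (dualE T) (b n)).
apply: corner_diagonal (reach_sequence n aP) _.
have := reach_sequence n bP; congr (@reach (dualE T) n _ _).
by rewrite /a /b /= GRing.subrK GRing.addr0 xz hom_src.
Qed.

End LeftResolving.

(** The square at [(n, n.+1)] links two consecutive squares of the main diagonal. *)
Lemma quadrant_diagonal (T : textile) (x : nat * nat -> edge (tF T)) :
  quadrant_shift T x ->
  one_sided_edge_shift (diagonal_graph T) (fun n => x (n, n)).
Proof.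
move=> xP n /=.
by rewrite (xP n n).2 -hom_ran (xP n n.+1).1 hom_src.
Qed.

(** * Paths of a single color in the two-graph *)

Definition horizontal_inclusion (T : textile) : ghom (tE T) (colored_graph T) :=
  @GHom (tE T) (colored_graph T) id inr (fun=> erefl) (fun=> erefl).

Definition vertical_inclusion (T : textile) : ghom (dualE T) (colored_graph T) :=
  @GHom (dualE T) (colored_graph T) id inl (fun=> erefl) (fun=> erefl).

Lemma tg_hom_path (T : textile) u d v : tg_hom T u d v !=set0 <->
  exists c : gpath (colored_graph T), [/\ path_degree c = d, psrc c = u & pran c = v].
Proof.
split=> [[l [ld lu lv]]|[c [cd cu cv]]]; first by exists (tg_repr l).
by exists (tg_of c); have [cr cs cdeg] := tg_ofE c; split; rewrite (cr, cs, cdeg).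
Qed.

Lemma walk_ghom (G H : digraph) (h : ghom G H) (u : vertex G) (l : seq (edge G)) :
  walk u l -> walk (hom0 h u) (map (hom1 h) l).
Proof.
elim: l u => //= e l IHl u [<- /IHl]; rewrite hom_ran; split=> //.
by rewrite hom_src.
Qed.

Definition gpath_map (G H : digraph) (h : ghom G H) (c : gpath G) : gpath H :=
  GPath (walk_ghom h (pwalk c)).

Lemma pran_gpath_map (G H : digraph) (h : ghom G H) (c : gpath G) :
  pran (gpath_map h c) = hom0 h (pran c).
Proof.
case: c => u l wl; rewrite /pran /= -map_comp -[in RHS]last_map -map_comp.
by congr last; apply: eq_map => e /=; rewrite hom_ran.
Qed.

(** Degree [(n, 0)] excludes every [inl] edge from a representative, which is thus a path in
    [tE T]. *)
Lemma tg_hom_horizontal (T : textile) u n v :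
  tg_hom T u (n, 0) v !=set0 <-> @reach (tE T) n u v.
Proof.
rewrite tg_hom_path; split=> [[[w l wl] [/= [<- l0] <- <-]]|].
  rewrite /pran /=; elim: l w wl l0 => [//|[//|e] l IHl] w /= [<- wl] l0.
  by exists e => //; exact: IHl.
move=> /reachP[c [<- <- <-]]; exists (gpath_map (horizontal_inclusion T) c).
by rewrite pran_gpath_map /path_degree /= !count_map count_predT count_pred0.
Qed.

Lemma tg_hom_vertical (T : textile) u n v :
  tg_hom T u (0, n) v !=set0 <-> @reach (dualE T) n u v.
Proof.
rewrite tg_hom_path; split=> [[[w l wl] [/= [l0 <-] <- <-]]|].
  rewrite /pran /=; elim: l w wl l0 => [//|[e|//] l IHl] w /= [<- wl] l0.
  by exists e => //; exact: IHl.
move=> /reachP[c [<- <- <-]]; exists (gpath_map (vertical_inclusion T) c).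
by rewrite pran_gpath_map /path_degree /= !count_map count_predT count_pred0.
Qed.

Theorem proposition4p4 (T : textile) (hLR : left_resolving T)
    (hF : finite_graph (tF T)) (hE : finite_graph (tE T)) :
  [<-> quadrant_shift T !=set0;
       one_sided_edge_shift (diagonal_graph T) !=set0;
       has_cycle (diagonal_graph T);
       exists (a : gpath (tE T)) (b : gpath (tE (dual T))),
         [/\ plength a = plength b, 0 < plength a,
             psrc a = pran b & pran a = psrc b];
       exists (n : nat) (nu omega : n.+1.-tuple (edge (tF T))),
         [/\ words (edge_shift (tF T)) nu,
             words (edge_shift (tF (dual T))) omega,
             tnth nu ord0 = tnth omega ord_max &
             tnth nu ord_max = tnth omega ord0];
       exists (u v : vertex (tE T)) (n : nat),
         [/\ 0 < n, tg_hom T u (n, 0) v !=set0 & tg_hom T v (0, n) u !=set0]].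
Proof.
(* A corner that returns to its starting vertex becomes a closed diagonal path. *)
have corner_cycle n u m : 0 < n -> @reach (tE T) n u m ->
    @reach (dualE T) n m u -> has_cycle (diagonal_graph T).
  case: n => // n _ um mu; apply/has_cycleP; exists n, u.
  exact: corner_diagonal um mu.
tfae.
- by move=> [x /quadrant_diagonal xP]; exists (fun n => x (n, n)).
- move=> [y yP]; apply: (@long_paths_cycle (diagonal_graph T) hE.1) => n.
  by exists (@src (diagonal_graph T) (y 0)), (@src (diagonal_graph T) (y n));
    exact: reach_sequence.
- move=> /has_cycleP[n [u /(diagonal_corner hLR)[m /reachP[a [an au am]]
    /reachP[b [bn bm bu]]]]].
  by exists a, b; rewrite an bn au bu am bm.
- move=> [a [b [ab a0 ba ab']]].
  have [|x xP] := cycle_plane hLR.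
    apply: (corner_cycle (plength a) (psrc a) (pran a)) => //.
      by apply/reachP; exists a.
    by apply/reachP; exists b.
  (* Words of length one suffice: take the single square at the origin. *)
  exists 0, [tuple x 0%R 0%R], [tuple x 0%R 0%R]; split=> //.
  + exists (x^~ 0%R); first by move=> i; exact: (xP i 0%R).1.
    by exists 0%R => k; rewrite ord1.
  + exists (x 0%R); first by move=> j; exact: (xP 0%R j).2.
    by exists 0%R => k; rewrite ord1.
- move=> [n [nu [omega [[x xP [i xi]] [z zP [j zj]] _]]]].
  rewrite xi zj => xz.
  have /has_cycleP[k [u /(diagonal_corner hLR)[m um mu]]] :=
    meeting_shifts_cycle hLR hE.1 xP zP xz.
  by exists u, m, k.+1; split=> //; [apply/tg_hom_horizontal|apply/tg_hom_vertical].
- move=> [u [m [n [n0 /tg_hom_horizontal um /tg_hom_vertical mu]]]].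
  have [x xP] := cycle_plane hLR (corner_cycle _ _ _ n0 um mu).
  (* The tiling of the plane is restricted to the quadrant. *)
  exists (fun ij => x ij.1%:Z ij.2%:Z)%R => i j /=.
  by have [-> ->] := xP i%:Z%R j%:Z%R; rewrite -!PoszD !addn1.
Qed.
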